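(* Let $q\ge 2$ and $m\ge 1$ be integers. Let $N^{\rm coord}_q(m)$ be the smallest natural number $N$ such that for every $n>N$ there is no A-primitive partition of ${\bf Z}_q^n$ into $q^m$ subcubes of dimension $n-m$, and let $c^{\rm coord*}_q(n,m)$ be the number of different unordered A-primitive partitions of ${\bf Z}_q^n$ into $q^m$ subcubes of dimension $n-m$. Then $$N^{\rm coord}_q(m)=\frac{q^m-1}{q-1}\quad\text{and}\quad c^{\rm coord*}_q\!\left(\frac{q^m-1}{q-1},m\right)=\left(\frac{q^m-1}{q-1}\right)!.$$
   Context: A $d$-dimensional subcube of ${\bf Z}_q^n$ is a subset obtained by fixing the values of some $n-d$ coordinates and letting each remaining coordinate run through all of ${\bf Z}_q$. A partition into subcubes is a collection of subcubes such that each vector of ${\bf Z}_q^n$ lies in exactly one of them. A partition into subcubes is A-primitive if every coordinate $i\in\{1,\dots,n\}$ is fixed in at least one subcube of the partition. It is known (from earlier work) that the number $N^{\rm coord}_q(m)$ exists, i.e. for each $m$ there is some $N$ beyond which no such A-primitive partitions exist. *)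

(* Defs.v *)
From mathcomp Require Import all_boot.
Set Implicit Arguments. Unset Strict Implicit. Unset Printing Implicit Defensive.

Definition vec (n q : nat) := {ffun 'I_n -> 'I_q}.

(* A subcube is described by, for each coordinate, either a fixed value
   (Some a) or "free" (None). For q >= 1 the subcube (as a set of vectors)
   determines its description uniquely. *)
Definition cube (n q : nat) := {ffun 'I_n -> option 'I_q}.

Definition in_cube n q (c : cube n q) (x : vec n q) : bool :=
  [forall i, if c i is Some a then x i == a else true].

Definition cdim n q (c : cube n q) : nat := #|[set i | c i == None]|.

Definition is_cube_partition n q (P : {set cube n q}) : bool :=
  [forall x : vec n q, #|[set c in P | in_cube c x]| == 1].

Definition A_primitive n q (P : {set cube n q}) : bool :=
  [forall i : 'I_n, [exists c in P, c i != None]].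

Definition prim_partition (q n m : nat) (P : {set cube n q}) : bool :=
  [&& is_cube_partition P, #|P| == q ^ m,
      [forall c in P, cdim c == n - m] & A_primitive P].
Arguments prim_partition q n m P : clear implicits.

Definition no_prim_beyond q m N : Prop :=
  forall n, N < n -> forall P : {set cube n q}, ~~ prim_partition q n m P.

Definition c_coord q n m : nat := #|[set P : {set cube n q} | prim_partition q n m P]|.

(* Main.v *)
Require Import Defs.
From mathcomp Require Import all_boot zify.
Set Implicit Arguments. Unset Strict Implicit. Unset Printing Implicit Defensive.

(* If [D] is a nonempty part of a partition into subcubes and [U] is the set of
   coordinates fixed by cubes of [D] but by no other cube, then
   [(q - 1) |U| + 1 <= |D|]: fix some [i] in [U] to each of its [q] values, give
   the cubes of [D] with [i] free to one of the resulting slices, and add up the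
   induction hypotheses.  Taking for [D] the whole partition bounds [n].

   When this bound is attained by the whole partition, some coordinate is fixed
   by all the cubes, and the bound is attained again in each slice along that
   coordinate.  Hence the partition consists of the leaves of a complete decision
   tree of depth [m]; it has [(q^m - 1) / (q - 1)] inner nodes, which query each
   coordinate exactly once, and distinct labellings of the nodes give distinct
   partitions. *)

(** * Slices of a partition *)

Section Slices.
Variables n q : nat.
Implicit Types (B c : cube n q) (F D S : {set cube n q}) (x : vec n q).

(** For [0 < q] this says that the two subcubes share a point, see [compat_point] and
    [point_compat]. *)
Definition compat B c : bool :=
  [forall i, [|| B i == None, c i == None | c i == B i]].

Definition slice F B := [set c in F | compat B c].

Definition upd B i (a : 'I_q) : cube n q :=
  [ffun j => if j == i then Some a else B j].

Definition free_count B := #|[set i | B i == None]|.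

Definition relevant B D : {set 'I_n} :=
  [set j | (B j == None) && [exists c in D, c j != None]].

(* The coordinates that become irrelevant once [D] is removed from the slice. *)
Definition private F B D := relevant B D :\: relevant B (slice F B :\: D).

Lemma compatP B c :
  reflect (forall i, [\/ B i = None, c i = None | c i = B i]) (compat B c).
Proof.
apply: (iffP forallP) => H i; move: (H i).
  by case/or3P => /eqP; [constructor 1|constructor 2|constructor 3].
by case=> ->; rewrite eqxx ?orbT.
Qed.

Lemma relevantP B D j :
  reflect (B j = None /\ exists2 c, c \in D & c j != None) (j \in relevant B D).
Proof.
rewrite inE; apply: (iffP andP).
  by case=> /eqP ? /existsP[c /andP[]]; split=> //; exists c.
case=> -> [c cD cj]; split=> //; apply/existsP; exists c; exact/andP.
Qed.

Lemma privateP F B D j :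
  reflect [/\ B j = None, exists2 c, c \in D & c j != None &
              forall c, c \in slice F B -> c \notin D -> c j = None]
          (j \in private F B D).
Proof.
rewrite inE; apply: (iffP andP).
  case=> /relevantP nj /relevantP[Bj ex]; split=> // c cs cD.
  by apply/eqP/negPn/negP=> cj; apply: nj; split=> //; exists c => //; rewrite in_setD cD.
case=> Bj ex all0; split; last exact/relevantP.
apply/relevantP; case=> _ [c]; rewrite in_setD => /andP[cD cs].
by rewrite all0.
Qed.

Lemma updE B i a j : upd B i a j = if j == i then Some a else B j.
Proof. by rewrite ffunE. Qed.

Lemma upd_free B i a j : upd B i a j = None -> j != i /\ B j = None.
Proof. by rewrite updE; case: eqP. Qed.

Lemma compat_upd B i a c : B i = None ->
  compat (upd B i a) c = compat B c && ((c i == None) || (c i == Some a)).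
Proof.
move=> Bi; apply/compatP/andP.
  move=> H; split.
    apply/compatP=> j; have := H j; rewrite updE; case: eqP => [->|//] _.
    by rewrite Bi; constructor 1.
  by move: (H i); rewrite updE eqxx => -[//|->|->]; rewrite ?eqxx ?orbT.
case=> /compatP H /orP[] /eqP ci j; have := H j; rewrite updE; case: eqP => // ->.
  by constructor 2.
by constructor 3.
Qed.

Lemma in_slice_upd F B i a c : B i = None ->
  (c \in slice F (upd B i a)) =
  (c \in slice F B) && ((c i == None) || (c i == Some a)).
Proof. by move=> Bi; rewrite !inE compat_upd // andbA. Qed.

Lemma free_count_upd B i a : B i = None -> free_count (upd B i a) < free_count B.
Proof.
move=> Bi; apply: proper_card; apply/properP; split.
  by apply/subsetP=> j; rewrite !inE => /eqP/upd_free[_ ->].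
by exists i; rewrite !inE ?Bi ?updE ?eqxx.
Qed.

Lemma in_cubeP c x :
  reflect (forall i a, c i = Some a -> x i = a) (in_cube c x).
Proof.
apply: (iffP forallP) => H i.
  by move=> a ci; have := H i; rewrite ci => /eqP.
by case ci: (c i) => [a|//]; apply/eqP/H.
Qed.

Lemma compat_point B c : 0 < q -> compat B c ->
  exists2 x, in_cube c x & in_cube B x.
Proof.
move=> q0 /compatP H; pose z := Ordinal q0.
exists [ffun i => if c i is Some a then a else odflt z (B i)].
  by apply/in_cubeP=> i a ci; rewrite ffunE ci.
apply/in_cubeP=> i a Bi; rewrite ffunE Bi /=.
by move: (H i); rewrite Bi => -[//|->|->].
Qed.

Lemma point_compat B c x : in_cube B x -> in_cube c x -> compat B c.
Proof.
move=> /in_cubeP HB /in_cubeP Hc; apply/compatP=> i.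
case Bi: (B i) => [a|]; last by constructor 1.
case ci: (c i) => [b|]; last by constructor 2.
by constructor 3; rewrite -(HB _ _ Bi) -(Hc _ _ ci).
Qed.

Lemma partition_ex F x : is_cube_partition F ->
  exists2 c, c \in F & in_cube c x.
Proof.
move/forallP/(_ x)/cards1P=> [c E].
by have := set11 c; rewrite -E inE => /andP[]; exists c.
Qed.

Lemma partition_uniq F x c c' : is_cube_partition F ->
  c \in F -> c' \in F -> in_cube c x -> in_cube c' x -> c = c'.
Proof.
move/forallP/(_ x)/cards1P=> [d E] cF c'F cx c'x.
have: c \in [set d] by rewrite -E inE cF.
have: c' \in [set d] by rewrite -E inE c'F.
by move=> /set1P-> /set1P->.
Qed.

(** Move a common point of [c] and [B] to the value [b] at [i]. If the cube of the new point left
    [i] free, it would also contain the old point and so be [c], which fixes [i]. *)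
Lemma slice_flip F B i c b : is_cube_partition F -> 0 < q ->
  c \in slice F B -> B i = None -> c i != None ->
  exists2 c', c' \in slice F B & c' i = Some b.
Proof.
move=> Fp q0; rewrite inE => /andP[cF cB] Bi ci.
have [x cx Bx] := compat_point q0 cB.
pose y : vec n q := [ffun j => if j == i then b else x j].
have [c' c'F c'y] := partition_ex y Fp.
have By : in_cube B y.
  apply/in_cubeP=> j a Bj; rewrite ffunE; case: eqP => [E|_].
    by rewrite E Bi in Bj.
  exact: (in_cubeP _ _ Bx).
exists c'; first by rewrite inE c'F (point_compat By c'y).
case ci': (c' i) => [a|]; first by rewrite -(in_cubeP _ _ c'y _ _ ci') ffunE eqxx.
have c'x : in_cube c' x.
  apply/in_cubeP=> j a c'j; have := in_cubeP _ _ c'y _ _ c'j; rewrite ffunE.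
  by case: eqP => // E; rewrite E ci' in c'j.
by move: ci; rewrite (partition_uniq Fp cF c'F cx c'x) ci'.
Qed.

(** * Splitting along a coordinate, and the counting bound *)

(* [a0] receives the cubes that leave coordinate [i] free. *)
Definition piece D i (a0 a : 'I_q) :=
  [set c in D | (c i == Some a) || (a == a0) && (c i == None)].

Lemma card_pieces D i a0 : #|D| = \sum_(a < q) #|piece D i a0 a|.
Proof.
rewrite -sum1_card (partition_big (fun c : cube n q => odflt a0 (c i)) xpredT) //=.
apply: eq_bigr => a _; rewrite -sum1_card; apply: eq_bigl => c; rewrite inE.
congr (_ && _); case: (c i) => [b|] /=; first by rewrite andbF orbF.
by rewrite andbT eq_sym.
Qed.

Lemma card_bigcup_leq (T I : finType) (G : I -> {set T}) :
  #|\bigcup_i G i| <= \sum_i #|G i|.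
Proof.
apply: (big_ind2 (fun (A : {set T}) k => #|A| <= k)) => //; first by rewrite cards0.
move=> A k A' k' hA hA'; rewrite (leq_trans (leq_card_setU _ _).1) //.
exact: leq_add.
Qed.

Lemma sum_mulS (I : finType) (P : pred I) (f : I -> nat) k :
  \sum_(i | P i) (k * f i).+1 = k * \sum_(i | P i) f i + #|P|.
Proof.
under eq_bigr => i _ do rewrite -addn1.
by rewrite big_split -big_distrr /= sum1_card.
Qed.

(** The pieces are nonempty by [slice_flip], since in the slice only cubes of [D] fix [i]. The last
    claim holds because every private coordinate other than [i] stays private for some piece. *)
Lemma private_pieces F B D i a0 : is_cube_partition F -> 0 < q ->
  D \subset slice F B -> i \in private F B D ->
  [/\ forall a, piece D i a0 a \subset slice F (upd B i a),
      forall a, piece D i a0 a != set0 &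
      #|private F B D| <= (\sum_(a < q) #|private F (upd B i a) (piece D i a0 a)|).+1].
Proof.
move=> Fp q0 sD /privateP[Bi [c cD ci] all0]; split=> [a|a|].
- apply/subsetP=> d; rewrite inE in_slice_upd // => /andP[dD H].
  by rewrite (subsetP sD) //=; case/orP: H => [->|/andP[_ ->]]; rewrite ?orbT.
- have [d ds di] := slice_flip a Fp q0 (subsetP sD _ cD) Bi ci.
  apply/set0Pn; exists d; rewrite inE di eqxx /= andbT.
  by apply/negPn/negP=> /(all0 _ ds); rewrite di.
rewrite -add1n -[X in X + _](cards1 i).
apply: leq_trans (leq_add (leqnn _) (card_bigcup_leq _)).
apply: leq_trans (leq_card_setU _ _).1.
apply: subset_leq_card; apply/subsetP=> j jU; rewrite in_setU1.
case: eqP => //= /eqP ji.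
have /privateP[Bj [d dD dj] all0j] := jU.
(* If a cube of [D] with [i] free fixes [j], then [j] is private for the piece [a0], which takes all
   such cubes. Otherwise [j] is private for the piece containing [d]. *)
pose S := [exists e in D, (e i == None) && (e j != None)].
have [/existsP[e /and3P[eD ei ej]]|nS] := boolP S.
  apply/bigcupP; exists a0 => //; apply/privateP; split.
  - by rewrite updE (negPf ji).
  - by exists e => //; rewrite inE eD ei eqxx orbT.
  - move=> f; rewrite in_slice_upd // => /andP[fs H]; rewrite inE eqxx /= => nf.
    by apply: all0j => //; apply: contra nf => ->; rewrite orbC.
case di: (d i) => [a|]; last first.
  by case/negP: nS; apply/existsP; exists d; rewrite dD di dj.
apply/bigcupP; exists a => //; apply/privateP; split.
- by rewrite updE (negPf ji).
- by exists d => //; rewrite inE dD di eqxx.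
move=> f; rewrite in_slice_upd // => /andP[fs H]; rewrite inE => nf.
have [fD|] := boolP (f \in D); last exact: all0j.
move: nf; rewrite fD /= negb_or => /andP[/negPf fia _].
rewrite fia orbF in H; apply/eqP/negPn/negP=> fj; case/negP: nS.
by apply/existsP; exists f; rewrite fD H.
Qed.

Lemma private_bound F : is_cube_partition F -> 0 < q ->
  forall B D, D \subset slice F B -> D != set0 ->
  q.-1 * #|private F B D| < #|D|.
Proof.
move=> Fp q0 B; have [k] := ubnP (free_count B).
elim: k B => // k IH B Bk D sD D0.
have [->|[i iU]] := set_0Vmem (private F B D); first by rewrite cards0 muln0 card_gt0.
have [s1 s2 s3] := private_pieces (Ordinal q0) Fp q0 sD iU.
have Bi : B i = None by case/privateP: iU.
have: \sum_(a < q) (q.-1 * #|private F (upd B i a) (piece D i (Ordinal q0) a)|).+1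
        <= #|D|.
  rewrite (card_pieces D i (Ordinal q0)); apply: leq_sum => a _; apply: IH => //.
  exact: leq_trans (free_count_upd a Bi) Bk.
rewrite sum_mulS card_ord.
(* Of the [q] units contributed by the successors, [q.-1] pay for the coordinate [i] and one keeps
   the inequality strict. *)
apply: leq_trans; rewrite -[X in _ + X](prednK q0) addnS ltnS addnC -mulnS.
by rewrite leq_mul2l s3 orbT.
Qed.

(** * Slices attaining the bound *)

Definition tight F B := #|slice F B| <= (q.-1 * #|relevant B (slice F B)|).+1.

Lemma private_slice F B : private F B (slice F B) = relevant B (slice F B).
Proof.
apply/setP=> j; apply/privateP/relevantP; first by case.
by case=> Bj ex; split=> // c ->.
Qed.

(** By [private_bound] the lower bounds for the pieces add up to the bound for the slice, so
    tightness of the slice leaves no slack in any piece, whatever [a0] is. *)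
Lemma tight_piece F B i a0 a : is_cube_partition F -> 0 < q ->
  tight F B -> i \in relevant B (slice F B) ->
  #|piece (slice F B) i a0 a| <=
    (q.-1 * #|private F (upd B i a) (piece (slice F B) i a0 a)|).+1.
Proof.
move=> Fp q0 tB iV; set D := slice F B.
have iD : i \in private F B D by rewrite private_slice.
have [s1 s2] := private_pieces a0 Fp q0 (subxx _) iD.
rewrite -/D => s3.
move: tB; rewrite /tight -private_slice -/D (card_pieces D i a0) (bigD1 a) //=.
move: s3; rewrite (bigD1 a) //=.
have: \sum_(b < q | b != a) (q.-1 * #|private F (upd B i b) (piece D i a0 b)|).+1
        <= \sum_(b < q | b != a) #|piece D i a0 b|.
  by apply: leq_sum => b _; apply: private_bound.
rewrite sum_mulS cardC1 card_ord.
move=> hT /(leq_mul (leqnn q.-1)); rewrite mulnS mulnDr => hU hp.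
rewrite -(leq_add2r (\sum_(b < q | b != a) #|piece D i a0 b|)) (leq_trans hp) //.
rewrite addSn ltnS (leq_trans hU) // addnC -addnA leq_add2l.
exact: leq_trans hT.
Qed.

Lemma piece_slice F B i a : B i = None ->
  piece (slice F B) i a a = slice F (upd B i a).
Proof.
by move=> Bi; apply/setP=> c; rewrite in_slice_upd // inE eqxx andTb orbC.
Qed.

(** With [a0 := a] the piece is the whole smaller slice. *)
Lemma tight_upd F B i a : is_cube_partition F -> 0 < q ->
  tight F B -> i \in relevant B (slice F B) -> tight F (upd B i a).
Proof.
move=> Fp q0 tB iV; have Bi : B i = None by case/relevantP: iV.
have := tight_piece a a Fp q0 tB iV.
by rewrite piece_slice // private_slice.
Qed.

(* A coordinate [r] fixed by every cube of the slice [i = a] is fixed by every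
   cube of the whole slice, because otherwise the cubes of the slice [i = a]
   that fix [i] would be too numerous. *)
Lemma tight_root F B : is_cube_partition F -> 1 < q -> tight F B ->
  relevant B (slice F B) != set0 ->
  exists2 r, r \in relevant B (slice F B) &
    forall c, c \in slice F B -> c r != None.
Proof.
move=> Fp q1; have q0 := ltnW q1.
have [k] := ubnP (free_count B); elim: k B => // k IH B Bk tB /set0Pn[i iV].
have [Bi [c0 c0s c0i]] := relevantP _ _ _ iV.
have [/existsP[s /andP[ss /eqP si]]|nS] :=
    boolP [exists s in slice F B, s i == None]; last first.
  exists i => // c cs; apply: contra nS => ci; apply/existsP; exists c.
  by rewrite cs.
pose a := Ordinal q0; pose b := Ordinal q1; pose Ba := upd B i a.
(* As [a] and [b] differ, the cubes with [i] free go to [b], and [P] keeps just those with value [a]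
   at [i]. *)
pose P := piece (slice F B) i b a.
have PE c : (c \in P) = (c \in slice F B) && (c i == Some a).
  by rewrite inE /= orbF.
have tBa : tight F Ba by exact: tight_upd.
have sa : s \in slice F Ba by rewrite in_slice_upd // ss si.
have [p ps pi] := slice_flip a Fp q0 c0s Bi c0i.
have pa : p \in slice F Ba by rewrite in_slice_upd // ps pi eqxx orbT.
(* The slice of [Ba] holds two distinct cubes, [p] and [s], so tightness forces a relevant
   coordinate. *)
have Va : relevant Ba (slice F Ba) != set0.
  apply: contraTneq tBa => V0; rewrite /tight V0 cards0 muln0 -ltnNge.
  apply: (@leq_trans #|[set p; s]|).
    by rewrite cards2; case: eqP => // E; rewrite E si in pi.
  by apply: subset_leq_card; apply/subsetP=> c /set2P[]->.
have [|r rV rall] := IH Ba _ tBa Va; first exact: leq_trans (free_count_upd a Bi) Bk.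
have [Bar [d da dr]] := relevantP _ _ _ rV.
have [ri Br] := upd_free Bar.
have Psub : P \subset slice F Ba.
  by apply/subsetP=> c; rewrite PE in_slice_upd // => /andP[-> ->]; rewrite orbT.
(* If the cubes of [P] took all [q] values at [r], splitting [P] along [r] would yield [q] extra
   units where tightness allows one. No private coordinate is lost: [r] is not private, as [s] lies
   outside [P] and fixes [r]. *)
have [v vP] : exists v : 'I_q, forall c, c \in P -> c r != Some v.
  case: (boolP [exists v : 'I_q, [forall c in P, c r != Some v]]).
    by move/existsP=> [v /forallP H]; exists v => c cP; have := H c; rewrite cP.
  rewrite negb_exists => /forallP H.
  have := tight_piece b a Fp q0 tB iV; rewrite -/P -/Ba.
  rewrite leqNgt => /negP[].
  have Hv v : q.-1 * #|private F (upd Ba r v) (piece P r a v)| < #|piece P r a v|.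
    apply: private_bound => //.
      apply/subsetP=> c; rewrite inE in_slice_upd // => /andP[/(subsetP Psub) cs].
      by rewrite cs (negPf (rall _ cs)) andbF orbF => ->.
    have := H v; rewrite negb_forall => /existsP[c]; rewrite negb_imply negbK.
    by move=> /andP[cP cr]; apply/set0Pn; exists c; rewrite inE cP cr.
  have : \sum_(v < q) (q.-1 * #|private F (upd Ba r v) (piece P r a v)|).+1 <= #|P|.
    by rewrite (card_pieces P r a); apply: leq_sum => v _; apply: Hv.
  rewrite sum_mulS card_ord.
  apply: leq_trans; rewrite -addn2 leq_add // leq_mul2l; apply/orP; right.
  apply: leq_trans (card_bigcup_leq _); apply: subset_leq_card.
  apply/subsetP=> j /privateP[Baj [c cP cj] all0].
  have cr := rall _ (subsetP Psub _ cP).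
  case crE: (c r) cr => [v|//] _; apply/bigcupP; exists v => //.
  have jr : j != r.
    apply: contraNneq (rall _ sa) => <-; apply/eqP; apply: all0 => //.
    by rewrite PE si andbF.
  apply/privateP; split; first by rewrite updE (negPf jr).
    by exists c => //; rewrite inE cP crE eqxx.
  move=> e; rewrite in_slice_upd // => /andP[es er]; rewrite inE => ne.
  apply: all0 => //; apply: contra ne => -> /=.
  by move: er; rewrite (negPf (rall _ es)) => /= ->.
exists r; last first.
  (* A cube [c] with [r] free meets the slice [r = v]. Either it has [i] free and lies in the slice
     of [Ba], or it flips to a cube [e] of [P] whose entry at [r] is free or [v]; both are
     excluded. *)
  move=> c cs; apply/negP=> cr.
  have cv : c \in slice F (upd B r v) by rewrite in_slice_upd // cs cr.
  have [ci|ci] := boolP (c i == None).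
    have ca : c \in slice F Ba by rewrite in_slice_upd // cs ci.
    by have := rall _ ca; rewrite cr.
  have Bvi : upd B r v i = None by rewrite updE eq_sym (negPf ri).
  have [e ev ei] := slice_flip a Fp q0 cv Bvi ci.
  move: ev; rewrite in_slice_upd // => /andP[es].
  have eP : e \in P by rewrite PE es ei eqxx.
  by rewrite (negPf (vP _ eP)) (negPf (rall _ (subsetP Psub _ eP))).
apply/relevantP; split=> //; exists d => //.
by move: da; rewrite in_slice_upd // => /andP[].
Qed.
Lemma slice_free F : slice F [ffun=> None] = F.
Proof.
apply/setP=> c; rewrite inE andb_idr // => _; apply/compatP=> j.
by constructor 1; rewrite ffunE.
Qed.

Lemma relevant_free F : A_primitive F -> relevant [ffun=> None] F = setT.
Proof.
move=> /forallP prim; apply/setP=> j; rewrite in_setT; apply/relevantP.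
by split; [rewrite ffunE | apply/exists_inP].
Qed.

End Slices.

(** * Decision trees *)

Section Trees.
Variables n q : nat.
Implicit Types (s t : seq 'I_q -> 'I_n) (u v w z : seq 'I_q) (x : vec n q).

(* A word lists the branches taken from the root, most recent first; [s u] is
   the coordinate queried at the node [u]. *)
Fixpoint node_cube s w : cube n q :=
  if w is a :: u then upd (node_cube s u) (s u) a else [ffun=> None].

(** The node at depth [k] reached by answering the queries of [s] with the entries of [x]. *)
Fixpoint branch s x k : seq 'I_q :=
  if k is k'.+1 then x (s (branch s x k')) :: branch s x k' else [::].

Definition inj_below m s :=
  forall u v, size u < m -> size v < m -> s u = s v -> u = v.

Definition onto_below m s := forall j, exists2 u, size u < m & s u = j.

Definition tree_leaves m s : {set cube n q} :=
  [set node_cube s (tval w) | w in [set: m.-tuple 'I_q]].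

Lemma tree_leavesP m s c :
  reflect (exists2 w, size w = m & c = node_cube s w) (c \in tree_leaves m s).
Proof.
apply: (iffP imsetP) => [[w _ ->]|[w sw ->]]; first by exists w; rewrite ?size_tuple.
by exists (Tuple (introT eqP sw)).
Qed.

(** Words grow at the head, so a proper suffix [z] is an ancestor of the node [w], and [a] is the
    branch taken there. *)
Lemma node_cube_cases s w j : node_cube s w j != None ->
  exists v a z, w = v ++ a :: z /\ s z = j.
Proof.
elim: w => [|a u IH] /=; first by rewrite ffunE.
rewrite updE; case: (j =P s u) => [-> _|_ /IH[v [b [z [-> <-]]]]]; first by exists [::], a, u.
by exists (a :: v), b, z.
Qed.

Lemma node_cube_fixed s v a u : node_cube s (v ++ a :: u) (s u) != None.
Proof.
elim: v => [|b v IH] /=; first by rewrite updE eqxx.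
by rewrite updE; case: (_ =P _ :> 'I_n).
Qed.

Lemma node_cube_free m s u : inj_below m s -> size u < m ->
  node_cube s u (s u) = None.
Proof.
move=> si su; apply/eqP/negPn/negP=> /node_cube_cases[v [a [z [uE sz]]]].
have zu : size z < size u by rewrite uE size_cat /=; lia.
by have E := si z u (ltn_trans zu su) su sz; rewrite E ltnn in zu.
Qed.

Lemma in_cube_upd (B : cube n q) i a x : B i = None ->
  in_cube (upd B i a) x = (x i == a) && in_cube B x.
Proof.
move=> Bi; apply/in_cubeP/andP=> [H|[/eqP xi /in_cubeP H] j b].
  split; first by apply/eqP/H; rewrite updE eqxx.
  apply/in_cubeP=> j b Bj; apply: H; rewrite updE; case: eqP => // E.
  by rewrite E Bi in Bj.
by rewrite updE; case: eqP => [-> [<-]|_ /H].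
Qed.

(** No coordinate is queried twice along a path, so membership is tested one query at a time. This
    is what makes the leaves a partition. *)
Lemma in_node_cube m s w x : inj_below m s -> size w <= m ->
  in_cube (node_cube s w) x = (w == branch s x (size w)).
Proof.
move=> si; elim: w => [|a u IH] /= sw.
  by apply/in_cubeP=> i a; rewrite ffunE.
rewrite in_cube_upd ?(node_cube_free si) // IH 1?ltnW // eqseq_cons.
by rewrite andbC [RHS]andbC; case: (u =P _) => //= <-; rewrite eq_sym.
Qed.

Lemma size_branch s x k : size (branch s x k) = k.
Proof. by elim: k => //= k ->. Qed.

Lemma branch_cat s x k l : exists v, branch s x (k + l) = v ++ branch s x l.
Proof.
elim: k => [|k [v IH]]; first by exists [::].
by exists (x (s (branch s x (k + l))) :: v); rewrite addSn /= {2}IH.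
Qed.

Lemma in_node_cube_cat m s v u x : inj_below m s -> size (v ++ u) <= m ->
  in_cube (node_cube s (v ++ u)) x -> in_cube (node_cube s u) x.
Proof.
move=> si; elim: v => //= a v IH sv.
by rewrite in_cube_upd ?(node_cube_free si) // => /andP[_]; apply/IH/ltnW.
Qed.

Lemma cube_point (c : cube n q) : 0 < q -> exists x, in_cube c x.
Proof.
move=> q0; have [|x cx _] := @compat_point _ _ c c q0; last by exists x.
by apply/compatP=> i; constructor 3.
Qed.

Lemma card_fixed_upd (B : cube n q) i a : B i = None ->
  #|[set j | upd B i a j != None]| = #|[set j | B j != None]|.+1.
Proof.
move=> Bi.
have -> : [set j | upd B i a j != None] = i |: [set j | B j != None].
  by apply/setP=> j; rewrite !inE updE; case: (j =P i).
by rewrite cardsU1 inE Bi.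
Qed.

Lemma card_fixed_node m s w : inj_below m s -> size w <= m ->
  #|[set j | node_cube s w j != None]| = size w.
Proof.
move=> si; elim: w => [|a u IH] /= sw.
  by apply/eqP; rewrite cards_eq0; apply/eqP/setP=> j; rewrite !inE ffunE.
by rewrite card_fixed_upd ?(node_cube_free si) // IH // ltnW.
Qed.

Lemma cdimE (c : cube n q) : cdim c = n - #|[set j | c j != None]|.
Proof.
have := cardsC [set j | c j == None]; rewrite /cdim card_ord => E.
have <- : ~: [set j | c j == None] = [set j | c j != None] by apply/setP=> j; rewrite !inE.
by rewrite -[X in X - _]E addnK.
Qed.

Lemma fixed_cdim (c : cube n q) m : m <= n -> cdim c = n - m ->
  #|[set j | c j != None]| = m.
Proof.
move=> mn; rewrite cdimE; have := max_card [set j | c j != None].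
rewrite card_ord; lia.
Qed.

Lemma node_cube_inj m s u v : 0 < q -> inj_below m s -> size u = m -> size v = m ->
  node_cube s u = node_cube s v -> u = v.
Proof.
move=> q0 si su sv E; have [x ux] := cube_point (node_cube s u) q0.
have := ux; rewrite E; move: ux; rewrite !(in_node_cube x si) ?su ?sv //.
by move=> /eqP-> /eqP->.
Qed.

Lemma tree_leaves_prim m s : 0 < q -> inj_below m s -> onto_below m s ->
  prim_partition q n m (tree_leaves m s).
Proof.
move=> q0 si so; apply/and4P; split.
- apply/forallP=> x; apply/cards1P; exists (node_cube s (branch s x m)).
  apply/setP=> c; rewrite !inE; apply/andP/eqP => [[/tree_leavesP[w sw ->]]|->].
    by rewrite (in_node_cube x si) sw // => /eqP <-.
  split; first by apply/tree_leavesP; exists (branch s x m); rewrite ?size_branch.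
  by rewrite (in_node_cube x si) size_branch ?eqxx.
- rewrite card_in_imset ?cardsT ?card_tuple ?card_ord // => u v _ _ E.
  by apply/val_inj/(node_cube_inj q0 si) => //; rewrite size_tuple.
- apply/forall_inP=> c /tree_leavesP[w sw ->].
  by rewrite cdimE (card_fixed_node si) sw.
apply/forallP=> j; have [u su <-] := so j; apply/exists_inP.
have a := Ordinal q0.
(* Any leaf below [u] fixes [s u]; this one takes the branch [a] at every step from [u] on. *)
exists (node_cube s (nseq (m - (size u).+1) a ++ a :: u)); last exact: node_cube_fixed.
apply/tree_leavesP; exists (nseq (m - (size u).+1) a ++ a :: u) => //.
by rewrite size_cat size_nseq /=; lia.
Qed.

(** Used for leaves that continue from [u] by a constant branch: an ancestor no shorter than [u]
    lies on that continuation. *)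
Lemma suffix_nseq_cat (T : Type) l (a : T) (u v z : seq T) :
  size u <= size z -> nseq l a ++ u = v ++ z -> z = nseq (size z - size u) a ++ u.
Proof.
move=> uz E; have S := congr1 size E; rewrite !size_cat size_nseq in S.
have -> : size z - size u = l - size v by lia.
have := congr1 (drop (size v)) E; rewrite [RHS]drop_size_cat // => <-.
rewrite drop_cat size_nseq; case: ltnP => h; first by rewrite drop_nseq.
have -> : size v - l = 0 by lia.
have -> : l - size v = 0 by lia.
by rewrite drop0.
Qed.

(* All leaves below the node [u] fix [t u], so the node where [s] queries [t u]
   is an ancestor of all of them, hence [u] itself or an ancestor of [u]. *)
Lemma tree_leaves_inj m s t : 1 < q -> inj_below m s -> inj_below m t ->
  tree_leaves m s = tree_leaves m t -> forall u, size u < m -> s u = t u.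
Proof.
move=> q1 si ti st u; have q0 := ltnW q1.
have [k] := ubnP (size u); elim: k u => // k IH u uk um.
have IHu z : size z < size u -> s z = t z.
  by move=> zu; apply: IH; [exact: leq_trans zu _ | exact: ltn_trans zu _].
have stu v : size v <= size u -> node_cube s v = node_cube t v.
  by elim: v => //= a v IHv vu; rewrite IHu // IHv // ltnW.
(* The leaf of [s] reached from [u] by always taking the branch [a] is also a leaf of [t]. It lies
   below [u] in [t] too, because the cubes of both trees at [u] agree, so it fixes [t u]. *)
have K a : exists v b z, nseq (m - size u) a ++ u = v ++ b :: z /\ s z = t u.
  set w := _ ++ u; have sw : size w = m by rewrite size_cat size_nseq subnK // ltnW.
  apply: node_cube_cases.
  have /tree_leavesP[w' sw' E] : node_cube s w \in tree_leaves m t.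
    by rewrite -st; apply/tree_leavesP; exists w.
  have [x xw] := cube_point (node_cube s w) q0.
  have xu : in_cube (node_cube s u) x by apply: (in_node_cube_cat si) xw; rewrite -/w sw.
  move: xw; rewrite E (in_node_cube x ti) sw' // => /eqP ->.
  move: xu; rewrite (stu u) // (in_node_cube x ti) 1?ltnW // => /eqP uE.
  rewrite -(subnK um); have [v ->] := branch_cat t x (m - (size u).+1) (size u).+1.
  by rewrite /= -uE node_cube_fixed.
have [v0 [b0 [z [E0 zE]]]] := K (Ordinal q0).
have [v1 [b1 [z1 [E1 z1E]]]] := K (Ordinal q1).
have sz v b y a : nseq (m - size u) a ++ u = v ++ b :: y -> size y < m.
  by move/(congr1 size); rewrite !size_cat size_nseq /=; lia.
have zz1 : z1 = z by apply: si; rewrite ?(sz _ _ _ _ E0) ?(sz _ _ _ _ E1) // z1E.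
have [zu|uz] := ltnP (size z) (size u).
  have tz : t z = t u by rewrite -IHu.
  by move: zu; rewrite (ti _ _ (sz _ _ _ _ E0) um tz) ltnn.
rewrite -zE; congr s.
rewrite {}zz1 -cat_rcons in E1; rewrite -cat_rcons in E0.
(* The continuations by [Ordinal q0] and [Ordinal q1] diverge immediately below [u], so a node on
   both is [u]. *)
have e0 := suffix_nseq_cat uz E0; have e1 := suffix_nseq_cat uz E1.
by move: e0 (etrans (esym e0) e1); case: (size z - size u) => [|d] //= _ [].
Qed.

(** * The decision tree of a partition attaining the bound *)

Variables (F : {set cube n q}) (i0 : 'I_n).

(** [i0] is only a default: [root_ofP] shows that tight slices with a relevant coordinate offer a
    genuine choice. *)
Definition root_of B : 'I_n :=
  odflt i0 [pick r in relevant B (slice F B) | [forall c in slice F B, c r != None]].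

Fixpoint root_cube w : cube n q :=
  if w is a :: u then upd (root_cube u) (root_of (root_cube u)) a else [ffun=> None].

Definition label w := root_of (root_cube w).

Lemma root_cubeE w : root_cube w = node_cube label w.
Proof. by elim: w => //= a u <-. Qed.

Lemma root_ofP B : is_cube_partition F -> 1 < q -> tight F B ->
  relevant B (slice F B) != set0 ->
  root_of B \in relevant B (slice F B) /\
  forall c, c \in slice F B -> c (root_of B) != None.
Proof.
move=> Fp q1 tB V0; rewrite /root_of; case: pickP => [r /andP[-> /forall_inP]|] //= H.
have [r rV rall] := tight_root Fp q1 tB V0.
by have /andP[] := H r; split=> //; apply/forall_inP.
Qed.

Hypotheses (q1 : 1 < q) (m : nat) (mn : m <= n) (Fprim : prim_partition q n m F).
Hypothesis Fcard : q ^ m <= (q.-1 * n).+1.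

Let Fp : is_cube_partition F. Proof. by case/and4P: Fprim. Qed.

Lemma card_fixed_prim c : c \in F -> #|[set j | c j != None]| = m.
Proof.
by move=> cF; case/and4P: Fprim => _ _ /forall_inP/(_ c cF)/eqP/(fixed_cdim mn).
Qed.

(** A cube of the slice fixes [m] coordinates but [root_cube u] only [size u], so some coordinate is
    still relevant and [root_ofP] applies. *)
Lemma root_of_slice u : size u < m -> tight F (root_cube u) ->
  #|[set j | root_cube u j != None]| = size u ->
  label u \in relevant (root_cube u) (slice F (root_cube u)) /\
  forall c, c \in slice F (root_cube u) -> c (label u) != None.
Proof.
move=> su tu cu; apply: root_ofP => //.
have [x xu] := cube_point (root_cube u) (ltnW q1).
have [c cF xc] := partition_ex x Fp.
have cs : c \in slice F (root_cube u) by rewrite inE cF (point_compat xu xc).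
have /subsetPn[j] : ~~ ([set j | c j != None] \subset [set j | root_cube u j != None]).
  by apply: contraL su => /subset_leq_card; rewrite card_fixed_prim // cu -leqNgt.
rewrite !inE negbK => cj /eqP uj; apply/set0Pn; exists j.
by apply/relevantP; split=> //; exists c.
Qed.

(** The coordinate queried at a node is fixed by every cube of its slice, so the cubes that follow a
    branch carry its value. *)
Lemma root_cube_inv w : size w <= m ->
  [/\ tight F (root_cube w),
      #|[set j | root_cube w j != None]| = size w &
      forall c j, c \in slice F (root_cube w) -> root_cube w j != None ->
        c j = root_cube w j].
Proof.
elim: w => [|a u IH] /= sw.
  split=> [||c j _]; last by rewrite ffunE.
    case/and4P: Fprim => _ /eqP cF _ prim.
    by rewrite /tight slice_free relevant_free // cardsT card_ord cF.
  by apply/eqP; rewrite cards_eq0; apply/eqP/setP=> j; rewrite !inE ffunE.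
have [tu cu ru] := IH (ltnW sw).
have [rV rall] := root_of_slice sw tu cu.
have [ur _] := relevantP _ _ _ rV.
split; first exact: tight_upd (ltnW q1) tu rV.
  by rewrite card_fixed_upd // cu.
move=> c j; rewrite in_slice_upd // => /andP[cs]; rewrite (negPf (rall _ cs)) /= => /eqP cr.
by rewrite updE; case: (j =P root_of _) => [->|_]; [rewrite cr | apply: ru].
Qed.

Lemma root_cube_step u c : size u < m -> c \in slice F (root_cube u) ->
  exists a, c \in slice F (root_cube (a :: u)).
Proof.
move=> su cs; have [tu cu _] := root_cube_inv (ltnW su).
have [/relevantP[ur _] /(_ c cs)] := root_of_slice su tu cu.
by case E: (c _) => [a|//] _; exists a; rewrite in_slice_upd // cs E eqxx orbT.
Qed.

(** Each cube of [F] descends to a leaf and agrees with it on all [m] fixed coordinates. There are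
    at most [q ^ m] leaves, so all occur, and A-primitivity makes every coordinate a query. *)
Lemma prim_tree : F = tree_leaves m label /\ onto_below m label.
Proof.
have Fsub : F \subset tree_leaves m label.
  apply/subsetP=> c cF.
  have [w sw cw] : exists2 w, size w = m & c \in slice F (root_cube w).
    suff : forall k, k <= m -> exists2 w, size w = k & c \in slice F (root_cube w) by apply.
    elim=> [_|k IH km].
      by exists [::] => //; rewrite slice_free.
    have [u su cu] := IH (ltnW km); rewrite -su in km.
    by have [a ca] := root_cube_step km cu; exists (a :: u); rewrite //= su.
  apply/tree_leavesP; exists w => //; rewrite -root_cubeE.
  have [_ cardw agree] := root_cube_inv (eq_leq sw).
  have /eqP E : [set j | root_cube w j != None] == [set j | c j != None].
    rewrite eqEcard cardw card_fixed_prim // sw leqnn andbT; apply/subsetP=> j.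
    by rewrite !inE => wj; rewrite (agree c j cw wj).
  apply/ffunP=> j; have [wj|] := boolP (root_cube w j != None); first exact: agree.
  have := congr1 (fun A : {set 'I_n} => j \in A) E; rewrite !inE => ->.
  rewrite negbK => /eqP cj; have: root_cube w j == None.
    by have := congr1 (fun A : {set 'I_n} => j \in A) E; rewrite !inE cj eqxx => /negbFE.
  by move/eqP->.
have FE : F = tree_leaves m label.
  apply/eqP; rewrite eqEcard Fsub; case/and4P: Fprim => _ /eqP -> _ _.
  by rewrite (leq_trans (leq_imset_card _ _)) // cardsT card_tuple card_ord.
split=> // j; case/and4P: Fprim => _ _ _ /forallP/(_ j)/exists_inP[c].
rewrite FE => /tree_leavesP[w sw ->] /node_cube_cases[v [a [z [wE zj]]]].
by exists z => //; rewrite -sw wE size_cat /=; lia.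
Qed.
End Trees.

(** * Counting *)

Section Counting.
Variables n q m : nat.
Implicit Types f : {ffun m.-bseq 'I_q -> 'I_n}.

(** Words of length at most [m] are the inner nodes of a tree of depth [m.+1]; longer words get a
    default value that the leaves never read. *)
Definition labelling f (u : seq 'I_q) := f (insub_bseq m u).

Lemma insub_bseqK (u : seq 'I_q) : size u <= m -> insub_bseq m u = u :> seq _.
Proof. by move=> su; rewrite /insub_bseq insubdK. Qed.

Lemma labelling_inj f : injective f -> inj_below m.+1 (labelling f).
Proof.
move=> fi u v; rewrite !ltnS => su sv /fi /(congr1 (@bseqval _ _)).
by rewrite !insub_bseqK.
Qed.

Lemma labelling_val f (u : m.-bseq 'I_q) : labelling f u = f u.
Proof. by congr (f _); apply/val_inj; rewrite /= insub_bseqK // size_bseq. Qed.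

Hypotheses (q1 : 1 < q) (cardn : #|{: m.-bseq 'I_q}| = n).

Lemma labelling_onto f : injective f -> onto_below m.+1 (labelling f).
Proof.
move=> fi j; have /codomP[u ->] : j \in codom f.
  by apply: inj_card_onto; rewrite // cardn card_ord.
by exists u; rewrite ?ltnS ?size_bseq ?labelling_val.
Qed.

(** There are as many inner nodes as coordinates, so a surjective labelling repeats none. *)
Lemma onto_labelling (s : seq 'I_q -> 'I_n) : onto_below m.+1 s ->
  injective [ffun u : m.-bseq 'I_q => s u].
Proof.
move=> so; set f := finfun _.
have /image_injP H : #|image f predT| == #|{: m.-bseq 'I_q}|.
  rewrite cardn -[X in _ == X](card_ord n); apply/eqP/eq_card => j.
  have [u su <-] := so j; rewrite !inE; apply/mapP; exists (insub_bseq m u).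
    by rewrite mem_enum.
  by rewrite ffunE insub_bseqK.
by move=> u v; apply: H.
Qed.

Lemma tree_leaves_eq (s t : seq 'I_q -> 'I_n) k : (forall u, size u < k -> s u = t u) ->
  tree_leaves k s = tree_leaves k t.
Proof.
move=> st; have E w : size w <= k -> node_cube s w = node_cube t w.
  by elim: w => //= a u IH su; rewrite st // IH // ltnW.
by apply/setP=> c; apply/tree_leavesP/tree_leavesP => -[w sw ->];
  exists w => //; rewrite E ?sw.
Qed.

Lemma prim_partitionsE : 0 < n -> m < n -> q ^ m.+1 = (q.-1 * n).+1 ->
  [set F : {set cube n q} | prim_partition q n m.+1 F] =
  [set tree_leaves m.+1 (labelling f) | f in
    [set f : {ffun m.-bseq 'I_q -> 'I_n} | injectiveb f]].
Proof.
move=> n0 mn qm; have q0 := ltnW q1; apply/setP=> F; rewrite inE.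
apply/idP/imsetP => [Fprim|[f]]; last first.
  rewrite inE => /injectiveP fi ->.
  exact: (tree_leaves_prim q0 (labelling_inj fi) (labelling_onto fi)).
have [FE so] := prim_tree (Ordinal n0) q1 mn Fprim (eq_leq qm).
pose f := [ffun u : m.-bseq 'I_q => label F (Ordinal n0) u].
exists f; first by rewrite inE; apply/injectiveP/onto_labelling.
rewrite {1}FE; apply: tree_leaves_eq => u su.
by rewrite /labelling ffunE insub_bseqK.
Qed.

Lemma card_prim_partitions : 0 < n -> m < n -> q ^ m.+1 = (q.-1 * n).+1 ->
  c_coord q n m.+1 = n`!.
Proof.
move=> n0 mn qm; rewrite /c_coord prim_partitionsE // card_in_imset.
  by rewrite card_inj_ffuns card_ord cardn ffactnn.
move=> f g; rewrite !inE => /injectiveP fi /injectiveP gi E; apply/ffunP=> u.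
rewrite -!labelling_val.
by apply: (tree_leaves_inj q1 (labelling_inj fi) (labelling_inj gi) E); rewrite ltnS size_bseq.
Qed.

End Counting.

(** * The bound on the number of coordinates, and the theorem *)

Lemma prim_partition_bound (n q m : nat) (P : {set cube n q}) :
  0 < q -> prim_partition q n m P -> q.-1 * n < q ^ m.
Proof.
move=> q0 /and4P[Pp /eqP cP _ prim]; rewrite -cP.
(* With the whole space for [B] and the whole partition for [D], A-primitivity makes every
   coordinate private. *)
have := @private_bound _ _ P Pp q0 [ffun=> None] (slice P [ffun=> None]) (subxx _).
rewrite private_slice slice_free relevant_free // cardsT card_ord; apply.
by rewrite -card_gt0 cP expn_gt0 q0.
Qed.

Theorem theorem7 (q m : nat) (hq : 2 <= q) (hm : 1 <= m) :
  let N0 := (q ^ m - 1) %/ (q - 1) in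
  [/\ no_prim_beyond q m N0,
      (forall N, no_prim_beyond q m N -> N0 <= N)
    & c_coord q N0 m = N0`!].
Proof.
move=> N0; case: m hm @N0 => // m _ N0.
have q0 := ltnW hq.
have q'0 : 0 < q.-1 by rewrite -subn1 subn_gt0.
have N0E : N0 = \sum_(i < m.+1) q ^ i.
  by rewrite /N0 !subn1 predn_exp mulKn.
have cardN : #|{: m.-bseq 'I_q}| = N0 by rewrite card_bseq card_ord.
have qm : q ^ m.+1 = (q.-1 * N0).+1.
  by rewrite N0E -predn_exp prednK // expn_gt0 q0.
(* Each of the [m.+1] terms of the geometric sum is at least 1. This keeps the subtraction in the
   dimension [N0 - m.+1] from being truncated. *)
have mN : m < N0.
  rewrite N0E -[X in X <= _](card_ord m.+1) -sum1_card; apply: leq_sum => i _.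
  by rewrite expn_gt0 q0.
have N00 : 0 < N0 by exact: leq_ltn_trans mN.
have count := card_prim_partitions hq cardN N00 mN qm.
split=> // [n nN P|N HN].
  apply/negP=> /(prim_partition_bound q0).
  by rewrite qm ltnS leq_pmul2l // leqNgt nN.
(* Minimality follows from the count: a factorial is positive, so a partition exists at [N0]
   itself. *)
rewrite leqNgt; apply/negP=> NN.
have : 0 < c_coord q N0 m.+1 by rewrite count fact_gt0.
by rewrite card_gt0 => /set0Pn[P]; rewrite inE (negPf (HN _ NN P)).
Qed.
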